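(* Let $0<\alpha<1$ be a real number and let $s\geq 1$ be an integer. Then there exists $n_0=n_0(\alpha,s)$ such that for every $n\geq n_0$ and every $F_s$-minor-free graph $G$ of order $n$, $$\rho_{\alpha}(G)\leq \rho_{\alpha}(K_s\vee \overline{K}_{n-s}),$$ with equality if and only if $G=K_s\vee\overline{K}_{n-s}$ (up to isomorphism).
   Context: All graphs are finite, simple and undirected; the order of a graph is its number of vertices. For a graph $G$, $A(G)$ is its adjacency matrix and $D(G)$ is the diagonal matrix of its vertex degrees. For $0\leq\alpha\leq 1$, $A_\alpha(G)=\alpha D(G)+(1-\alpha)A(G)$, and the $\alpha$-index $\rho_\alpha(G)$ is the largest eigenvalue of $A_\alpha(G)$. $K_n$ is the complete graph on $n$ vertices, $\overline{G}$ is the complement of $G$ (so $\overline{K}_{m}$ is the edgeless graph on $m$ vertices), $kG$ is the disjoint union of $k$ copies of $G$, and $G\vee H$ is the join of vertex-disjoint graphs $G$ and $H$, obtained from their disjoint union by joining every vertex of $G$ to every vertex of $H$. The friendship graph $F_s=K_1\vee sK_2$ consists of $s$ triangles sharing one common vertex. A graph $H$ is a minor of $G$ if $H$ can be obtained from a subgraph of $G$ by contracting edges; $G$ is $H$-minor-free if $H$ is not a minor of $G$. *)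

(* Defs.v *)
From HB Require Import structures.
From mathcomp Require Import all_boot all_order all_algebra.
From mathcomp Require Import classical_sets reals.

Set Implicit Arguments.
Unset Strict Implicit.
Unset Printing Implicit Defensive.

Import Order.TTheory GRing.Theory Num.Theory.

Local Open Scope ring_scope.

Record sgraph := SGraph {
  vertex :> finType;
  adj : rel vertex;
  adj_sym : symmetric adj;
  adj_irr : irreflexive adj }.

Definition isomorphic (G H : sgraph) : Prop :=
  exists2 f : G -> H, bijective f & forall x y, adj (f x) (f y) = adj x y.

Section Constructions.

Definition complete_adj n : rel 'I_n := fun i j => i != j.

Fact complete_adj_sym n : symmetric (@complete_adj n).
Proof. by move=> i j; rewrite /complete_adj eq_sym. Qed.

Fact complete_adj_irr n : irreflexive (@complete_adj n).
Proof. by move=> i; rewrite /complete_adj eqxx. Qed.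

Definition complete n : sgraph :=
  SGraph (@complete_adj_sym n) (@complete_adj_irr n).

Definition compl_adj (G : sgraph) : rel G := fun x y => (x != y) && ~~ adj x y.

Fact compl_adj_sym G : symmetric (@compl_adj G).
Proof. by move=> x y; rewrite /compl_adj eq_sym adj_sym. Qed.

Fact compl_adj_irr G : irreflexive (@compl_adj G).
Proof. by move=> x; rewrite /compl_adj eqxx. Qed.

Definition compl (G : sgraph) : sgraph :=
  SGraph (@compl_adj_sym G) (@compl_adj_irr G).

Definition copies_adj k (G : sgraph) : rel ('I_k * G) :=
  fun x y => (x.1 == y.1) && adj x.2 y.2.

Fact copies_adj_sym k G : symmetric (@copies_adj k G).
Proof. by move=> x y; rewrite /copies_adj eq_sym adj_sym. Qed.

Fact copies_adj_irr k G : irreflexive (@copies_adj k G).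
Proof. by move=> x; rewrite /copies_adj adj_irr andbF. Qed.

Definition copies k (G : sgraph) : sgraph :=
  SGraph (@copies_adj_sym k G) (@copies_adj_irr k G).

Definition join_adj (G H : sgraph) : rel (G + H) := fun x y =>
  match x, y with
  | inl a, inl b => adj a b
  | inr a, inr b => adj a b
  | _, _ => true
  end.

Fact join_adj_sym G H : symmetric (@join_adj G H).
Proof. by move=> [a|a] [b|b] //=; rewrite adj_sym. Qed.

Fact join_adj_irr G H : irreflexive (@join_adj G H).
Proof. by move=> [a|a] /=; rewrite adj_irr. Qed.

Definition join (G H : sgraph) : sgraph :=
  SGraph (@join_adj_sym G H) (@join_adj_irr G H).

End Constructions.

Definition friendship s : sgraph := join (complete 1) (copies s (complete 2)).

Section Contraction.

Variables (G : sgraph) (u v : G).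

(* The vertex v is merged into u, which is kept as the name of the new
   vertex; loops and parallel edges are discarded. *)
Definition merge (x : G) : G := if x == v then u else x.

Definition contract_adj : rel {x : G | x != v} := fun a b =>
  (a != b) &&
  [exists x, exists y, [&& merge x == val a, merge y == val b & adj x y]].

Fact contract_adj_sym : symmetric contract_adj.
Proof.
suff imp a b : contract_adj a b -> contract_adj b a.
  by move=> a b; apply/idP/idP; apply: imp.
case/andP=> nab /existsP[x /existsP[y /and3P[xa yb xy]]].
rewrite /contract_adj eq_sym nab; apply/existsP; exists y.
by apply/existsP; exists x; rewrite xa yb adj_sym.
Qed.

Fact contract_adj_irr : irreflexive contract_adj.
Proof. by move=> a; rewrite /contract_adj eqxx. Qed.

Definition contract : sgraph := SGraph contract_adj_sym contract_adj_irr.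

End Contraction.

Inductive contracts_to : sgraph -> sgraph -> Prop :=
| contracts_iso G H : isomorphic G H -> contracts_to G H
| contracts_edge (G : sgraph) (u v : G) H :
    adj u v -> contracts_to (contract u v) H -> contracts_to G H.

(* Up to isomorphism: H embeds in G, not necessarily as an induced subgraph. *)
Definition subgraph (H G : sgraph) : Prop :=
  exists2 f : H -> G, injective f & forall x y, adj x y -> adj (f x) (f y).

Definition minor (H G : sgraph) : Prop :=
  exists2 G' : sgraph, subgraph G' G & contracts_to G' H.

Definition minor_free (H G : sgraph) : Prop := ~ minor H G.

Section AlphaIndex.

Variables (R : realType) (alpha : R) (G : sgraph).

Definition degree (x : G) : nat := #|[pred y | adj x y]|.

Definition adjacency_mx : 'M[R]_#|G| :=
  \matrix_(i, j) (adj (enum_val i) (enum_val j))%:R.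

Definition degree_mx : 'M[R]_#|G| :=
  diag_mx (\row_i (degree (enum_val i))%:R).

Definition alpha_mx : 'M[R]_#|G| :=
  alpha *: degree_mx + (1 - alpha) *: adjacency_mx.

(* The set of eigenvalues is finite, and nonempty when G has a vertex since
   alpha_mx is real symmetric, so that this supremum is a maximum. *)
Definition alpha_index : R := sup [set mu | eigenvalue alpha_mx mu]%classic.

End AlphaIndex.

(* Main.v *)
Require Import Defs.
From mathcomp Require Import all_boot all_order all_algebra.
From mathcomp Require Import reals.
From mathcomp Require Import ring zify.

(** An F_s-minor-free graph G of order n has O(n) edges. Let x be a Perron vector
of A_alpha(G) with maximum 1 and eigenvalue r, and suppose that r is at least the
alpha-index of the join K of K_s with an edgeless graph, which equals
alpha n - 1 + (1 - alpha) s / alpha + O(1/n). Summing the eigenvalue equation over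
all vertices shows that x has bounded sum, so x_v = O(1/n) unless v is a hub,
i.e. adjacent to almost all vertices. There are at most s hubs, as s + 1 of them
give an F_s minor. At the maximum of x the eigenvalue equation yields
r <= alpha n - 1 + (1 - alpha) X / alpha + O(1/n), where X is the sum of x over the
hubs; hence there are s hubs and their entries are bounded below. Now replace
G by the copy of K whose clique consists of the hubs. An added edge increases
the quadratic form of x by at least a constant, while the removed edges
contribute O(1/n); so no edge is added. An edge of G between two vertices that
are not hubs would then give an F_s minor, so G = K. *)

Set Implicit Arguments.
Unset Strict Implicit.
Unset Printing Implicit Defensive.

(** * Minor models *)

Section Models.
Implicit Types G H : sgraph.

Definition fiber_rel G (T : eqType) (phi : G -> T) : rel G :=
  [rel x y | adj x y && (phi x == phi y)].

(* phi sends a vertex to the branch set containing it, if any. *)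
Record minor_model H G (phi : G -> option H) : Prop := MinorModel {
  model_onto : forall h, exists x, phi x = Some h;
  model_connect : forall x y, phi x -> phi x = phi y ->
    connect (fiber_rel phi) x y;
  model_adj : forall h k, adj h k ->
    exists x y, [/\ phi x = Some h, phi y = Some k & adj x y] }.

Definition has_model H G := exists phi : G -> option H, minor_model phi.

Lemma connect_morph (T U : finType) (e : rel T) (e' : rel U) (f : T -> U) :
  (forall x y, e x y -> connect e' (f x) (f y)) ->
  forall x y, connect e x y -> connect e' (f x) (f y).
Proof.
move=> ee' x y /connectP [p pth ->]; elim: p x pth => [|z p IH] x /=.
  by rewrite connect0.
by case/andP => /ee' xz /IH; apply: connect_trans.
Qed.

Lemma fiber_relC G (T : eqType) (phi : G -> T) : symmetric (fiber_rel phi).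
Proof. by move=> x y; rewrite /fiber_rel /= adj_sym eq_sym. Qed.

Lemma merge_neq G (u v : G) : u != v -> forall x, Defs.merge u v x != v.
Proof. by move=> uv x; rewrite /Defs.merge; case: ifPn. Qed.

Lemma merge_id G (u v x : G) : x != v -> Defs.merge u v x = x.
Proof. by rewrite /Defs.merge => /negPf->. Qed.

Lemma adj_neq G (u v : G) : adj u v -> u != v.
Proof. by apply: contraTneq => ->; rewrite adj_irr. Qed.

Definition merge_sub G (u v : G) (uv : adj u v) (x : G) : contract u v :=
  exist _ (Defs.merge u v x) (merge_neq (adj_neq uv) x).

Lemma merge_subK G (u v : G) (uv : adj u v) (a : contract u v) :
  merge_sub uv (val a) = a.
Proof. by apply: val_inj; rewrite /= merge_id // (valP a). Qed.

Lemma contract_merge G (u v : G) (uv : adj u v) x y : adj x y ->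
  merge_sub uv x != merge_sub uv y ->
  adj (merge_sub uv x) (merge_sub uv y).
Proof.
move=> xy ne; rewrite /adj /= /contract_adj ne /=; apply/existsP; exists x.
by apply/existsP; exists y; rewrite /= !eqxx.
Qed.

Lemma contract_lift G (u v : G) (uv : adj u v) (a b : contract u v) :
  adj a b ->
  exists x y, [/\ merge_sub uv x = a, merge_sub uv y = b & adj x y].
Proof.
case/andP=> _ /existsP [x /existsP [y /and3P [/eqP xa /eqP yb xy]]].
by exists x, y; split=> //; apply: val_inj.
Qed.

Lemma card_contract G (u v : G) : #|contract u v| = #|G|.-1.
Proof. by rewrite /= card_sig cardC1. Qed.

(** A model of the contraction pulls back along the merging map: [v] joins the branch set of [u], if
    any, and the edge [uv] keeps that set connected. *)
Lemma has_model_contract G H (u v : G) : adj u v ->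
  has_model H (contract u v) -> has_model H G.
Proof.
move=> uv [psi [onto conn padj]]; pose phi x := psi (merge_sub uv x).
have to_merge x : connect (fiber_rel phi) x (val (merge_sub uv x)).
  rewrite /=; have [xv|xv] := eqVneq x v; last by rewrite merge_id.
  rewrite /Defs.merge xv eqxx connect1 // /fiber_rel /= adj_sym uv /phi.
  apply/eqP; congr (psi _).
  by apply: val_inj; rewrite /= /Defs.merge eqxx (negPf (adj_neq uv)).
have sc : connect_sym (fiber_rel phi) by exact/sym_connect_sym/fiber_relC.
exists phi; split=> [h|x y hx xy|h k /padj [a [b [ha hb ab]]]].
- by have [a ha] := onto h; exists (val a); rewrite /phi merge_subK.
- rewrite (connect_trans (to_merge x)) // sc (connect_trans (to_merge y)) // sc.
  apply: connect_morph (conn _ _ hx xy) => a b /= /andP [ab pab].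
  have [x' [y' [xa yb xy']]] := contract_lift uv ab.
  rewrite -xa -yb sc (connect_trans (y := x')) // sc.
  apply: connect_trans (to_merge y'); rewrite connect1 // /fiber_rel /= xy' /phi xa yb.
  exact: pab.
- have [x [y [xa yb xy]]] := contract_lift uv ab.
  by exists x, y; rewrite /phi xa yb.
Qed.

(** Induction on [#|G|]: if [phi] is not injective, some edge lies inside a fibre, and contracting
    it preserves the hypotheses; if [phi] is injective, it is an isomorphism. *)
Lemma contracts_to_quotient G H (phi : G -> H) :
  (forall h, exists x, phi x = h) ->
  (forall x y, phi x = phi y -> connect (fiber_rel phi) x y) ->
  (forall h k, adj h k -> exists x y, [/\ phi x = h, phi y = k & adj x y]) ->
  (forall x y, adj x y -> phi x != phi y -> adj (phi x) (phi y)) ->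
  contracts_to G H.
Proof.
have [n] := ubnP #|G|; elim: n G phi => // n IH G phi Gn onto conn lift proj.
have [inj|] := boolP (injectiveb phi).
  apply: contracts_iso; exists phi => [|x y].
    apply: inj_card_bij; first exact/injectiveP.
    rewrite -(card_codom (injectiveP _ inj)) subset_leq_card //.
    by apply/subsetP => h _; have [x <-] := onto h; apply: codom_f.
  apply/idP/idP => [/lift [x' [y' []]]|xy]; first by do 2!move/(injectiveP _ inj) ->.
  apply: proj => //; apply: contraTneq xy => /(injectiveP _ inj) ->.
  by rewrite adj_irr.
case/injectivePn => x [y xy pxy].
have /connectP [[|u p] /= pth yE] := conn x y pxy.
  by rewrite yE eqxx in xy.
have {p pth yE} /andP [/andP [xu /eqP pxu] _] := pth.
pose psi (a : contract x u) := phi (val a).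
have psiE z : psi (merge_sub xu z) = phi z.
  by rewrite /psi /= /Defs.merge; case: eqP => // ->.
apply: (contracts_edge xu); apply: (IH _ psi) => [|h|a b pab|h k hk|a b ab pab].
- by rewrite card_contract; have : (0 < #|G|)%N by [apply/card_gt0P; exists x]; lia.
- by have [z <-] := onto h; exists (merge_sub xu z).
- rewrite -[a](merge_subK xu) -[b](merge_subK xu).
  apply: connect_morph (conn _ _ pab) => z w /= /andP [zw pzw].
  have [->|ne] := eqVneq (merge_sub xu z) (merge_sub xu w); first exact: connect0.
  by apply: connect1; rewrite /fiber_rel /= !psiE pzw andbT; exact: contract_merge.
- have [z [w [zh wk zw]]] := lift _ _ hk.
  have ne : merge_sub xu z != merge_sub xu w.
    by apply: contraTneq hk => /(congr1 psi); rewrite !psiE zh wk => ->; rewrite adj_irr.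
  exists (merge_sub xu z), (merge_sub xu w); rewrite !psiE.
  by split=> //; exact: contract_merge.
- have [z [w [za wb zw]]] := contract_lift xu ab.
  by move: pab; rewrite -za -wb !psiE; apply: proj.
Qed.

Section BranchGraph.
Variables (H G : sgraph) (phi : G -> option H).

(** Edges between two branch sets are kept only where [H] has an edge, so that contracting the
    branch sets yields [H] itself and no further edges. *)
Definition branch_adj : rel {x | phi x} := fun a b =>
  adj (val a) (val b) && match phi (val a), phi (val b) with
  | Some h, Some k => (h == k) || adj h k
  | _, _ => false
  end.

Fact branch_adj_sym : symmetric branch_adj.
Proof.
move=> a b; rewrite /branch_adj adj_sym; case: (phi _) (phi _) => [h|] [k|] //.
by rewrite [k == h]eq_sym [adj k h]adj_sym.
Qed.

Fact branch_adj_irr : irreflexive branch_adj.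
Proof. by move=> a; rewrite /branch_adj adj_irr. Qed.

Definition branch_graph : sgraph := SGraph branch_adj_sym branch_adj_irr.

Lemma minor_of_model : minor_model phi -> minor H G.
Proof.
case=> onto conn lift; exists branch_graph.
  by exists val => [|a b /andP []] //; exact: val_inj.
have /fin_all_exists [psi psiE] (a : branch_graph) : exists h, phi (val a) = Some h.
  by case: a => x /=; case: (phi x) => // h _; exists h.
have phiT x h : phi x = Some h -> phi x by move=> ->.
apply: (@contracts_to_quotient _ _ psi) => [h|a b ab|h k hk|a b].
- have [x xh] := onto h; exists (Sub x (phiT _ _ xh)).
  by apply: Some_inj; rewrite -psiE.
- have pab : phi (val a) = phi (val b) by rewrite !psiE ab.
  have /connectP [p pth yE] := conn _ _ (valP a) pab.
  elim: p a pth yE {ab pab} => [|z p IH] a /= pth yE.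
    by rewrite (val_inj (esym yE : val a = val b)) connect0.
  have {pth} /andP [/andP [az /eqP paz] pth] := pth.
  have zT : phi z by rewrite -paz (valP a).
  apply: connect_trans (IH (Sub z zT) pth yE).
  apply: connect1; rewrite /fiber_rel /= /branch_adj /= az /=.
  have E : psi a = psi (Sub z zT) by apply: Some_inj; rewrite -!psiE.
  by rewrite E eqxx andbT paz (psiE (Sub z zT) : phi z = _) eqxx.
- have [x [y [xh yk xy]]] := lift _ _ hk.
  exists (Sub x (phiT _ _ xh)), (Sub y (phiT _ _ yk)).
  split; try by apply: Some_inj; rewrite -psiE.
  by rewrite /= /branch_adj /= xy xh yk hk orbT.
- by case/andP => _; rewrite !psiE => /orP [->|].
Qed.

End BranchGraph.

Lemma minor_of_has_model H G : has_model H G -> minor H G.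
Proof. by case=> phi; apply: minor_of_model. Qed.

End Models.

(** * Friendship minors *)

Section Friendship.
Implicit Types G : sgraph.

(** With all first components listed before the second ones, the [j]-th end of the [i]-th pair has
    index [i + j * size m]. *)
Definition matched (T : eqType) (m : seq (T * T)) := unzip1 m ++ unzip2 m.

Lemma size_matched (T : eqType) (m : seq (T * T)) : size (matched m) = (size m).*2.
Proof. by rewrite size_cat !size_map addnn. Qed.

(* The branch set of the centre is {c, c'}. *)
Lemma friendship_model G (c c' : G) (m : seq (G * G)) :
  (c == c') || adj c c' -> uniq (matched m) -> all (fun p => adj p.1 p.2) m ->
  {in matched m, forall z, [&& z != c, z != c' & adj c z || adj c' z]} ->
  has_model (friendship (size m)) G.
Proof.
move=> cc' um am hub; set s := size m.
pose M (ij : 'I_s * 'I_2) := nth c (matched m) (ij.1 + ij.2 * s).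
have sm : size (matched m) = s + s by rewrite size_matched addnn.
have ltM (ij : 'I_s * 'I_2) : ij.1 + ij.2 * s < size (matched m).
  by rewrite sm; case: ij => [[i ?] [[|[|j]] ?]] //=; lia.
have MP ij : [&& M ij != c, M ij != c' & adj c (M ij) || adj c' (M ij)].
  by apply: hub; apply: mem_nth.
have M0 (i : 'I_s) : M (i, ord0) = (nth (c, c) m i).1.
  by rewrite /M /= mul0n addn0 nth_cat size_map ltn_ord (nth_map (c, c)).
have M1 (i j : 'I_s) : M (i, lift ord0 ord0) = (nth (c, c) m i).2.
  rewrite /M /= mul1n nth_cat size_map ltnNge leq_addl /= addnK.
  by rewrite (nth_map (c, c)).
have Madj i j j' : j != j' -> adj (M (i, j)) (M (i, j')).
  have ami : adj (nth (c, c) m i).1 (nth (c, c) m i).2.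
    by apply: (all_nthP (c, c) am).
  have ord2 (k : 'I_2) : k = ord0 \/ k = lift ord0 ord0.
    by case: k => [[|[|k]] kP] //; [left | right]; apply: val_inj.
  case: (ord2 j) => ->; case: (ord2 j') => ->; rewrite ?eqxx // ?M0 ?M1 // adj_sym //.
have Minj : injective M.
  move=> [i j] [i' j'] /eqP; rewrite nth_uniq // => /eqP /= E.
  have [ij] : (val i = val i') /\ (val j = val j').
    by case: i i' j j' E {M0 M1} => [i ?] [i' ?] [[|[|j]] ?] [[|[|j']] ?] //=; lia.
  by move=> jj; congr (_, _); apply: val_inj.
pose phi x : option (friendship s) :=
  if (x == c) || (x == c') then Some (inl ord0)
  else omap inr [pick ij | M ij == x].
have phic : phi c = Some (inl ord0) by rewrite /phi eqxx.
have phic' : phi c' = Some (inl ord0) by rewrite /phi eqxx orbT.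
have phiM ij : phi (M ij) = Some (inr ij).
  have /and3P [/negPf n1 /negPf n2 _] := MP ij.
  rewrite /phi n1 n2 /=; case: pickP => [kl /eqP /Minj -> //|/(_ ij)].
  by rewrite eqxx.
have phiP x h : phi x = Some h -> match h return Prop with
    | inl _ => (x == c) || (x == c') | inr ij => x = M ij end.
  rewrite /phi; case: ifP => [xc [<-] //|_].
  by case: pickP => //= kl /eqP <- [<-].
exists phi; split=> [[i|ij]|x y xT pxy|[i|ij] [k|kl] hk].
- by exists c; rewrite phic (ord1 i).
- by exists (M ij).
- case px : (phi x) xT => [[i|ij]|] // _; rewrite px in pxy.
    have sc := sym_connect_sym (fiber_relC phi).
    have conn1 z : (z == c) || (z == c') -> connect (fiber_rel phi) c z.
      case/orP => /eqP ->; first exact: connect0.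
      case/orP: cc' => [/eqP->|cc']; first exact: connect0.
      by apply: connect1; rewrite /fiber_rel /= cc' phic phic' eqxx.
    apply: (connect_trans (y := c)).
      by rewrite sc; apply: conn1; apply: phiP px.
    by apply: conn1; apply: phiP (esym pxy).
  by rewrite (phiP _ _ px) (phiP _ _ (esym pxy)) connect0.
- by case/negP: hk; rewrite (ord1 i) (ord1 k).
- have /and3P [_ _ /orP [] az] := MP kl.
    by exists c, (M kl); rewrite phic phiM (ord1 i).
  by exists c', (M kl); rewrite phic' phiM (ord1 i).
- have /and3P [_ _ /orP [] az] := MP ij.
    by exists (M ij), c; rewrite phic phiM (ord1 k) adj_sym.
  by exists (M ij), c'; rewrite phic' phiM (ord1 k) adj_sym.
- exists (M ij), (M kl); rewrite !phiM; split=> //.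
  case: ij kl hk => [i j] [i' j'] /andP [/= /eqP <-].
  exact: Madj.
Qed.

(* The branch set of the centre is {u, y} for some y in W, and U is matched
   into W. *)
Lemma friendship_hub G (u : G) (U : seq G) (m : seq (G * G)) (W : {set G}) :
  uniq (U ++ matched m) -> u \notin U ++ matched m ->
  all (fun p => adj p.1 p.2) m ->
  {in matched m, forall z, adj u z} ->
  {in W, forall w, adj u w && all (adj w) U} ->
  (size U + size m).*2 < #|W| ->
  has_model (friendship (size U + size m)) G.
Proof.
move=> uU nu am mu WU Wbig.
(* One vertex of [W] outside [m] is put into the branch set of the centre, and [size U] others
   become the partners of [U]. *)
have ltW : size U < #|W :\: [set z in matched m]|.
  have := cardsID [set z in matched m] W.
  have : #|W :&: [set z in matched m]| <= size (matched m).
    rewrite (leq_trans _ (card_size (matched m))) // subset_leq_card //.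
    by apply/subsetP => z; rewrite !inE => /andP [].
  move: Wbig; rewrite size_matched doubleD; set a := size U; set b := size m.
  by move=> *; lia.
pose Y := take (size U).+1 (enum (W :\: [set z in matched m])).
have sY : size Y = (size U).+1 by rewrite size_takel // -cardE.
have uY : uniq Y by rewrite take_uniq // enum_uniq.
have YP z : z \in Y -> (z \in W) && (z \notin matched m).
  by move/mem_take; rewrite mem_enum !inE andbC.
clearbody Y; case: Y sY uY YP => // y0 Y [sY] /andP [ny0 uY] YP.
have {}uY : uniq Y := uY; have {}ny0 : y0 \notin Y := ny0.
have [y0W y0m] := andP (YP y0 (mem_head _ _)).
have sm : size (zip U Y ++ m) = size U + size m.
  by rewrite size_cat size_zip sY minnn.
have nadj z w : z \in W -> w \in U -> w != z.
  by move=> /WU /andP [_ /allP h] /h; apply: contraTneq => ->; rewrite adj_irr.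
have YW z : z \in Y -> z \in W.
  by move=> zY; have /andP [] := YP z (mem_behead (s := _ :: _) zY).
have Ym z : z \in Y -> z \notin matched m.
  by move=> zY; have /andP [] := YP z (mem_behead (s := _ :: _) zY).
have mE : perm_eq (matched (zip U Y ++ m)) ((U ++ matched m) ++ Y).
  rewrite /matched /unzip1 /unzip2 !map_cat -/unzip1 -/unzip2 -!/(unzip1 _) -!/(unzip2 _).
  rewrite unzip1_zip ?sY // unzip2_zip ?sY // -!catA perm_cat2l perm_cat2l.
  exact/permPl/perm_catC.
have uy0 : adj u y0 by have /andP [] := WU _ y0W.
rewrite -sm; apply: (@friendship_model _ u y0).
- by rewrite uy0 orbT.
- rewrite (perm_uniq mE) cat_uniq uU uY andbT /=; apply/hasPn => z zY.
  rewrite mem_cat (negPf (Ym z zY)) orbF.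
  by apply/negP => /(nadj z _ (YW z zY)); rewrite eqxx.
- rewrite all_cat am andbT; apply/allP => p pz.
  have p1 : p.1 \in U by rewrite -(@unzip1_zip _ _ U Y) ?sY //; apply: map_f.
  have p2 : p.2 \in Y by rewrite -(@unzip2_zip _ _ U Y) ?sY //; apply: map_f.
  by rewrite adj_sym; have /andP [_ /allP ->] := WU _ (YW _ p2).
- move=> z; rewrite (perm_mem mE) mem_cat => /orP [zUm|zY].
    rewrite (memPn nu z zUm) /=; move: zUm; rewrite mem_cat => /orP [zU|zm].
      rewrite (nadj _ _ y0W zU) /=; have /andP [_ /allP ->] := WU _ y0W; rewrite ?orbT //.
    by rewrite (memPn y0m z zm) (mu z zm).
  have /andP [uz _] := WU _ (YW z zY).
  by rewrite (memPn ny0 z zY) uz andbT eq_sym (adj_neq uz).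
Qed.

Lemma greedy_matching G (N : {set G}) d :
  N != set0 -> (forall w, w \in N -> d.*2 <= #|[set z in N | adj w z]|) ->
  exists m : seq (G * G), [/\ size m = d, uniq (matched m),
    all (fun p => adj p.1 p.2) m & {subset matched m <= N}].
Proof.
move=> /set0Pn [w0 w0N] Ndeg.
have Nd : d.*2 <= #|N|.
  apply: leq_trans (Ndeg _ w0N) _; apply: subset_leq_card.
  by apply/subsetP => z; rewrite inE => /andP [].
suff: forall k, k <= d -> exists m : seq (G * G), [/\ size m = k, uniq (matched m),
    all (fun p => adj p.1 p.2) m & {subset matched m <= N}] by apply.
elim=> [|k IH] kd; first by exists [::].
have [m [sm um am mN]] := IH (ltnW kd).
have avoid (A : {set G}) : d.*2 <= #|A| -> exists2 z, z \in A & z \notin matched m.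
  move=> dA; case: (pickP [pred z in A | z \notin matched m]) => [z /andP []|none].
    by exists z.
  have : #|A| <= size (matched m).
    apply: leq_trans (card_size _); apply: subset_leq_card; apply/subsetP => z zA.
    by have := none z; rewrite /= zA /= => /negbFE.
  by rewrite size_matched sm; lia.
have [w wN wm] := avoid N Nd; have [z] := avoid _ (Ndeg w wN).
rewrite inE => /andP [zN wz] zm; exists ((w, z) :: m).
have mE : perm_eq (matched ((w, z) :: m)) (w :: z :: matched m).
  rewrite /matched /= perm_cons -[z :: unzip2 m]cat1s -[z :: unzip1 m ++ _]cat1s.
  by rewrite !catA perm_cat2r; apply/permPl/perm_catC.
split=> [|||x]; rewrite ?(perm_uniq mE) ?(perm_mem mE) /= ?sm ?wz //.
  by rewrite inE negb_or (adj_neq wz) wm zm.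
by rewrite !inE => /or3P [/eqP->|/eqP->|/mN].
Qed.

(** * Edge bound for graphs without a friendship minor *)

Definition arcs G : {set G * G} := [set p | adj p.1 p.2].

Lemma card_arcs G : #|arcs G| = \sum_(x : G) degree x.
Proof.
rewrite -sum1_card (eq_bigl (fun p : G * G => xpredT p.1 && adj p.1 p.2)); last first.
  by move=> p; rewrite inE.
rewrite -(pair_big_dep xpredT (fun x y => adj x y) (fun _ _ => 1)) /=.
by apply: eq_bigr => x _; rewrite sum1_card.
Qed.

Definition common_nbrs G (u v : G) := [set z | adj u z & adj v z].

(** Contracting loses the edge [uv] and one edge per common neighbour, and each edge counts as two
    arcs. *)
Lemma card_arcs_contract G (u v : G) (uv : adj u v) :
  #|arcs G| <= #|arcs (contract u v)| + #|common_nbrs u v|.+1.*2.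
Proof.
pose C := u |: common_nbrs u v.
(* These pairs join [v] to [u] or to a common neighbour; on the remaining arcs, merging is injective
   and creates no loop. *)
pose bad := setX [set v] C :|: setX C [set v].
have badC : #|bad| <= #|common_nbrs u v|.+1.*2.
  apply: leq_trans (leq_card_setU _ _) _; rewrite !cardsX cards1 mul1n muln1.
  by rewrite addnn leq_double cardsU1; lia.
rewrite -(cardsID bad (arcs G)) addnC leq_add //; last first.
  by apply: leq_trans badC; rewrite subset_leq_card // subsetIr.
pose f (p : G * G) := (merge_sub uv p.1, merge_sub uv p.2).
have bad1 y : adj v y -> y = u \/ adj u y -> (v, y) \in bad.
  by move=> vy uy; rewrite !inE eqxx /= vy andbT; case: uy => [->|->]; rewrite ?eqxx ?orbT.
have bad2 y : adj v y -> y = u \/ adj u y -> (y, v) \in bad.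
  by move=> vy uy; rewrite !inE eqxx /= vy !andbT; case: uy => [->|->]; rewrite ?eqxx ?orbT.
have mE x y : Defs.merge u v x = Defs.merge u v y ->
    [\/ x = y, x = u /\ y = v | x = v /\ y = u].
  rewrite /Defs.merge.
  by do 2!case: eqP => [->|_]; move=> *; subst;
    [constructor 1|constructor 3|constructor 2|constructor 1].
rewrite -(@card_in_imset _ _ f) => [|[x y] [x' y'] ].
  apply: subset_leq_card; apply/subsetP => _ /imsetP [[x y] /setDP [xy nb] ->].
  rewrite inE /=; rewrite inE /= in xy.
  apply: contract_merge => //; apply: contraNneq nb => /(congr1 val) /mE [E|[E1 E2]|[E1 E2]].
  - by rewrite E adj_irr in xy.
  - by rewrite E1 E2; apply: bad2; [rewrite adj_sym | left].
  - by rewrite E1 E2; apply: bad1; [rewrite adj_sym | left].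
move=> /setDP [xy nb] /setDP [xy' nb'] [/mE Ex /mE Ey].
rewrite inE /= in xy; rewrite inE /= in xy'.
case: Ex Ey => [E|[E1 E2]|[E1 E2]] [F|[F1 F2]|[F1 F2]]; subst=> //.
- by case/negP: nb'; apply: bad2; [|right]; rewrite adj_sym.
- by case/negP: nb; apply: bad2; [|right]; rewrite adj_sym.
- by case/negP: nb'; apply: bad1 => //; right.
- by rewrite adj_irr in xy.
- by case/negP: nb; apply: bad2; [rewrite adj_sym|left].
- by case/negP: nb; apply: bad1 => //; right.
- by case/negP: nb; apply: bad1 => //; left.
- by rewrite adj_irr in xy.
Qed.

(* If no edge with few common neighbours is left to contract, every vertex of a
   nonempty neighbourhood has large degree inside it, so that the neighbourhood
   contains a matching of size s. *)
Lemma card_arcs_model_free s G : ~ has_model (friendship s) G ->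
  #|arcs G| <= (4 * s) * #|G|.
Proof.
have [n] := ubnP #|G|; elim: n G => // n IH G Gn free.
have [[u v] /andP [uv few]|many] :=
  pickP [pred p : G * G | adj p.1 p.2 && (#|common_nbrs p.1 p.2| < s.*2)].
  (* With fewer than [2 * s] common neighbours, the contraction loses at most [4 * s] arcs and
     exactly one vertex. *)
  have G0 : 0 < #|G| by apply/card_gt0P; exists u.
  have cE := card_contract u v; have := card_arcs_contract uv.
  have : #|arcs (contract u v)| <= 4 * s * #|contract u v|.
    apply: IH; first by rewrite cE; lia.
    by move=> /(has_model_contract uv).
  by rewrite cE; move: few; rewrite /=; case: #|G| G0 => // k _; rewrite mulnS /=; lia.
have [[v w]|no_arc] := pickP [pred p : G * G | adj p.1 p.2].
  rewrite /= => vw; case: free; pose N := [set z | adj v z].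
  have [||m [<- um am mN]] := @greedy_matching G N s.
  - by apply/set0Pn; exists w; rewrite inE.
  - move=> z; rewrite inE => vz; have := many (v, z); rewrite /= vz /= => /negbT.
    rewrite -leqNgt => /leq_trans; apply; apply: subset_leq_card.
    by apply/subsetP => x; rewrite !inE.
  apply: (@friendship_model _ v v) => //; first by rewrite eqxx.
  move=> z /mN; rewrite inE => vz.
  by rewrite orbb vz eq_sym (adj_neq vz).
rewrite (_ : arcs G = set0) ?cards0 //; apply/setP => -[x y].
by have := no_arc (x, y); rewrite !inE.
Qed.

End Friendship.

(** * Vertices adjacent to almost all others *)

Section Hubs.
Variables (G : sgraph) (s : nat).
Hypothesis free : ~ has_model (friendship s) G.
Hypothesis G_big : (4 * s < #|G|)%N.

(** Each vertex of [T] excludes at most [d] candidates. *)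
Lemma common_nbrs_ge (d : nat) (T : seq G) :
  {in T, forall v, (#|G| <= degree v + d)%N} ->
  (#|G| <= #|[set w : G | all (adj w) T]| + size T * d)%N.
Proof.
elim: T => [|v T IH] Td.
  by rewrite (_ : [set _ | _] = setT) ?cardsT ?leq_addr //; apply/setP => w; rewrite !inE.
have /IH IHT : {in T, forall v, (#|G| <= degree v + d)%N}.
  by move=> w wT; apply: Td; rewrite inE wT orbT.
have vd := Td v (mem_head _ _).
have := cardsID [set w | adj v w] [set w : G | all (adj w) T].
have -> : [set w : G | all (adj w) T] :&: [set w | adj v w] = [set w | all (adj w) (v :: T)].
  by apply/setP => w; rewrite !inE /= andbC adj_sym.
have := cardsC [set w | adj v w].
have : (#|[set w : G | all (adj w) T] :\: [set w | adj v w]| <= #|~: [set w | adj v w]|)%N.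
  by apply: subset_leq_card; apply/subsetP => w; rewrite !inE => /andP [].
have -> : #|[set w | adj v w]| = degree v by rewrite cardsE.
rewrite [size (v :: T)]/= mulSn.
move: IHT vd; set a := #|[set w | all (adj w) T]|; set b := #|[set w | all (adj w) (v :: T)]|.
move=> IHT vd h1 h2 h3. lia.
Qed.

(* The threshold ensures that s + 1 hubs share half of the vertices as common
   neighbours. *)
Definition hubs : {set G} := [set v | #|G| <= degree v + #|G| %/ (2 * s.+1)]%N.

Lemma common_hubs (T : seq G) : (size T <= s.+1)%N -> {subset T <= hubs} ->
  (#|G| <= 2 * #|[set w : G | all (adj w) T]|)%N.
Proof.
move=> sT TL; have := @common_nbrs_ge (#|G| %/ (2 * s.+1)) T.
have Td : {in T, forall v, (#|G| <= degree v + #|G| %/ (2 * s.+1))%N}.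
  by move=> v /TL; rewrite inE.
move=> /(_ Td); have : (size T * (#|G| %/ (2 * s.+1)) <= s.+1 * (#|G| %/ (2 * s.+1)))%N.
  by rewrite leq_mul2r sT orbT.
have := leq_divM #|G| (2 * s.+1).
set q := (_ %/ _)%N; set a := (size T * q)%N; set b := (s.+1 * q)%N.
have -> : (q * (2 * s.+1) = 2 * b)%N by rewrite /b; ring.
lia.
Qed.

(** Of [s + 1] hubs, one serves as the centre and the other [s] are matched into their common
    neighbours, of which there are more than [2 * s]. *)
Lemma card_hubs : (#|hubs| <= s)%N.
Proof.
rewrite leqNgt; apply/negP => Lbig; apply: free.
pose T := take s.+1 (enum hubs).
have sT : size T = s.+1 by rewrite size_takel // -cardE.
have uT : uniq T by rewrite take_uniq // enum_uniq.
have TL : {subset T <= hubs} by move=> v /mem_take; rewrite mem_enum.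
have := common_hubs; move=> /(_ T); rewrite sT => /(_ (leqnn _) TL).
move: sT uT; case: T {TL} => // u U [sU] /andP [nu uU] W2.
have sE : (size U + size (Nil (G * G)) = s)%N by rewrite addn0.
rewrite -sE; apply: (@friendship_hub G u U [::] [set w : G | all (adj w) (u :: U)]).
- by rewrite cats0.
- by rewrite cats0.
- by [].
- by [].
- by move=> w; rewrite inE /= adj_sym.
- by rewrite sE; lia.
Qed.

(** With [u] as centre, the edge [yz] gives one triangle, and the other [s - 1] hubs, matched into
    the common neighbours of all hubs, give the rest. *)
Lemma hubs_no_triangle (u y z : G) : #|hubs| = s -> u \in hubs ->
  y \notin hubs -> z \notin hubs -> adj y z -> adj u y -> adj u z -> False.
Proof.
move=> cL uL yL zL yz uy uz; apply: free.
pose U := rem u (enum hubs).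
have uU : uniq (u :: U).
  by rewrite -(perm_uniq (perm_to_rem _)) ?mem_enum // enum_uniq.
have UL v : v \in u :: U -> v \in hubs.
  by rewrite -(perm_mem (perm_to_rem _)) ?mem_enum.
have sU : (size U + size [:: (y, z)] = s)%N.
  rewrite /= size_rem ?mem_enum // -cardE cL addn1 prednK // -cL.
  by apply/card_gt0P; exists u.
have W2 : (#|G| <= 2 * #|[set w : G | all (adj w) (u :: U)]|)%N.
  by apply: common_hubs => //; rewrite -sU /= addn1.
rewrite -sU; apply: (@friendship_hub G u U [:: (y, z)] [set w : G | all (adj w) (u :: U)]).
- rewrite cat_uniq (proj2 (andP uU) : uniq U) /= !inE (adj_neq yz) !andbT orbF /=.
  apply/norP; split; apply/negP => h.
    by rewrite UL ?inE ?h ?orbT in yL.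
  by rewrite UL ?inE ?h ?orbT in zL.
- have nu : u \notin U := proj1 (andP uU); rewrite mem_cat (negPf nu) /= !inE.
  by rewrite (negPf (adj_neq uy)) (negPf (adj_neq uz)).
- by rewrite /= yz.
- by move=> v; rewrite /matched /= !inE => /orP [] /eqP ->.
- by move=> w; rewrite inE /= adj_sym.
- by rewrite sU; lia.
Qed.

End Hubs.

Lemma isomorphic_sym G1 G2 : isomorphic G1 G2 -> isomorphic G2 G1.
Proof.
move=> [f [g gf fg] fadj]; exists g; first by exists f.
by move=> v w; rewrite -fadj !fg.
Qed.

(** * The extremal graph on a given vertex set *)

Section SplitGraph.
Variables (G : sgraph) (L : {set G}).

(** Keeping the vertices of [G] allows one and the same function to be tested on both graphs. *)
Definition split_adj : rel G := fun v w => (v != w) && ((v \in L) || (w \in L)).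

Fact split_adj_sym : symmetric split_adj.
Proof. by move=> v w; rewrite /split_adj eq_sym orbC. Qed.

Fact split_adj_irr : irreflexive split_adj.
Proof. by move=> v; rewrite /split_adj eqxx. Qed.

Definition split_graph : sgraph := SGraph split_adj_sym split_adj_irr.

Lemma split_graph_iso s n : #|L| = s -> #|G| = n ->
  isomorphic split_graph (Defs.join (complete s) (compl (complete (n - s)))).
Proof.
move=> cL cG; have cL' : #|~: L| = (n - s)%N by rewrite cardsCs setCK cG cL.
apply: isomorphic_sym.
pose g (z : 'I_s + 'I_(n - s)) : G := match z with
  | inl i => enum_val (cast_ord (esym cL) i)
  | inr j => enum_val (cast_ord (esym cL') j) end.
have gL i : g (inl i) \in L by exact: enum_valP.
have gL' j : (g (inr j) \in L) = false.
  by apply/negbTE; rewrite -in_setC; exact: enum_valP.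
have ginj : injective g.
  move=> [i|i] [j|j] gij.
  - by move/enum_val_inj/cast_ord_inj: gij => ->.
  - by have := gL i; rewrite gij gL'.
  - by have := gL j; rewrite -gij gL'.
  - by move/enum_val_inj/cast_ord_inj: gij => ->.
exists g.
  apply: inj_card_bij ginj _ => /=.
  by rewrite card_sum !card_ord cG subnKC // -cL -cG max_card.
move=> v w /=; rewrite /split_adj (inj_eq ginj).
case: v w => [i|i] [j|j]; rewrite ?gL ?gL' /= ?orbT ?andbT ?andbF //.
by rewrite /compl_adj /= /complete_adj negbK; case: eqP.
Qed.

End SplitGraph.

(* Imported only here, since classical set notations hide those of finset. *)
From mathcomp Require Import all_classical all_reals all_analysis.
From mathcomp Require Import lra.

Import Order.TTheory GRing.Theory Num.Theory.
Import numFieldNormedType.Exports.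

Local Open Scope ring_scope.

(** * The largest eigenvalue *)

Section SymmetricMatrix.
Variables (R : realType) (n : nat) (M : 'M[R]_n).

Definition qform (w : 'rV[R]_n) := \sum_i \sum_j M i j * (w 0 i * w 0 j).
Definition sqnorm (w : 'rV[R]_n) := \sum_i w 0 i ^+ 2.

Lemma sqnorm_ge0 w : 0 <= sqnorm w.
Proof. by apply: sumr_ge0 => i _; apply: sqr_ge0. Qed.

Lemma sqnorm_eq0 w : (sqnorm w == 0) = (w == 0).
Proof.
apply/eqP/eqP => [/eqP|->]; last by apply: big1 => i _; rewrite mxE expr0n.
rewrite psumr_eq0 => [/allP h|i _]; last exact: sqr_ge0.
apply/rowP => i; rewrite mxE; apply/eqP.
by have := h i (mem_index_enum i); rewrite sqrf_eq0.
Qed.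

Lemma qformZ a w : qform (a *: w) = a ^+ 2 * qform w.
Proof.
rewrite /qform big_distrr; apply: eq_bigr => i _ /=.
by rewrite big_distrr; apply: eq_bigr => j _ /=; rewrite !mxE; ring.
Qed.

Lemma sqnormZ a w : sqnorm (a *: w) = a ^+ 2 * sqnorm w.
Proof.
by rewrite /sqnorm big_distrr; apply: eq_bigr => i _ /=; rewrite !mxE; ring.
Qed.

Lemma continuous_coordM i j : continuous (fun w : 'rV[R]_n => w 0 i * w 0 j).
Proof.
by move=> w; apply: continuousM; apply: coord_continuous.
Qed.

Lemma continuous_qform : continuous qform.
Proof.
move=> w; rewrite /qform; apply: continuous_big => [|i _]; first exact: add_continuous.
move=> {}w; apply: continuous_big => [|j _]; first exact: add_continuous.
move=> {}w.
by apply: (@cvgM _ _ (nbhs w)); [exact: cvg_cst | exact: continuous_coordM].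
Qed.

Lemma continuous_sqnorm : continuous sqnorm.
Proof.
move=> w; rewrite /sqnorm; apply: continuous_big => [|i _]; first exact: add_continuous.
move=> {}w.
by under eq_fun do rewrite expr2; exact: continuous_coordM.
Qed.

Lemma compact_sphere : compact [set w | sqnorm w = 1].
Proof.
apply: bounded_closed_compact.
  exists 1; split=> // b b1 w /= w1.
  rewrite /Num.norm /= mx_normrE; apply/bigmax_leP; split=> [|[i j] _]; first lra.
  rewrite /= (ord1 i) (le_trans _ (ltW b1)) // -(ler_pXn2r (ltn0Sn 1)) ?nnegrE //.
  rewrite expr1n real_normK ?num_real // -w1 /sqnorm (bigD1 j) //= lerDl.
  by apply: sumr_ge0 => k _; apply: sqr_ge0.
rewrite (_ : [set w | _] = sqnorm @^-1` [set 1])%classic //.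
apply: closed_comp; first by move=> w _; exact: continuous_sqnorm.
exact: closed_eq.
Qed.

Hypothesis n_gt0 : (0 < n)%N.

(* A maximiser of the Rayleigh quotient stays one after taking absolute values
   of its entries when M is nonnegative. *)
Lemma rayleigh_max : (forall i j, 0 <= M i j) ->
  exists2 c : 'rV[R]_n, (forall i, 0 <= c 0 i) & sqnorm c = 1 /\
    forall w, qform w <= qform c * sqnorm w.
Proof.
move=> M_ge0.
have [||c cS cmax] := EVT_max_rV _ compact_sphere (f := qform).
- exists (\row_j (j == Ordinal n_gt0)%:R) => /=.
  rewrite /sqnorm (bigD1 (Ordinal n_gt0)) //= mxE eqxx expr1n big1 ?addr0 //.
  by move=> i /negPf ni; rewrite mxE ni expr0n.
- by apply: continuous_subspaceT => w; exact: continuous_qform.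
rewrite inE /= in cS; pose c' := \row_j `|c 0 j|.
have c'1 : sqnorm c' = 1.
  by rewrite -cS; apply: eq_bigr => i _; rewrite mxE real_normK ?num_real.
exists c' => [i|]; first by rewrite mxE.
split=> // w; have [->|wn0] := eqVneq w 0.
  by rewrite -(scale0r (0 : 'rV[R]_n)) qformZ sqnormZ expr0n !mul0r mulr0.
have w_gt0 : 0 < sqnorm w by rewrite lt_def sqnorm_ge0 sqnorm_eq0 wn0.
pose a := (Num.sqrt (sqnorm w))^-1.
have a2 : a ^+ 2 = (sqnorm w)^-1 by rewrite exprVn sqr_sqrtr // ltW.
have := cmax (a *: w); rewrite inE /= sqnormZ a2 mulVf ?gt_eqF // => /(_ erefl).
rewrite qformZ a2 mulrC ler_pdivrMr // => /le_trans; apply.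
apply: ler_wpM2r; first exact: sqnorm_ge0.
apply: ler_sum => i _; apply: ler_sum => j _; rewrite !mxE.
by apply: ler_wpM2l => //; rewrite -normrM ler_norm.
Qed.

Hypothesis Msym : forall i j, M i j = M j i.

(** The residual [y] is half the gradient at [c] of [qform - lam * sqnorm]. Moving [c] by [t *: y]
    raises this difference by [2 * t * sqnorm y] up to a term of order [t ^+ 2], which contradicts
    maximality unless [y] vanishes. *)
Lemma rayleigh_eigen (c : 'rV[R]_n) lam :
  qform c = lam * sqnorm c -> (forall w, qform w <= lam * sqnorm w) ->
  c *m M = lam *: c.
Proof.
move=> cE cmax; pose y := c *m M - lam *: c.
suff /eqP : sqnorm y = 0 by rewrite sqnorm_eq0 subr_eq0 => /eqP.
have ME j : (c *m M) 0 j = \sum_i c 0 i * M i j by rewrite mxE.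
have dE t : qform (c + t *: y) - lam * sqnorm (c + t *: y) =
    t * (sqnorm y *+ 2) + t ^+ 2 * (qform y - lam * sqnorm y).
  have -> : sqnorm (c + t *: y) =
      sqnorm c + t * (\sum_i c 0 i * y 0 i) *+ 2 + t ^+ 2 * sqnorm y.
    rewrite /sqnorm !(mulr_sumr, sumrMnl, mulrnAr) -?sumrMnl -!big_split /=.
    by apply: eq_bigr => i _; rewrite !mxE -mulr_natr; ring.
  have -> : qform (c + t *: y) =
      qform c + t * (\sum_j (c *m M) 0 j * y 0 j) *+ 2 + t ^+ 2 * qform y.
    have sw : \sum_i \sum_j M i j * (c 0 i * y 0 j) =
        \sum_j (c *m M) 0 j * y 0 j.
      rewrite exchange_big; apply: eq_bigr => j _ /=; rewrite ME mulr_suml.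
      by apply: eq_bigr => i _; ring.
    have sw' : \sum_i \sum_j M i j * (y 0 i * c 0 j) =
        \sum_j (c *m M) 0 j * y 0 j.
      rewrite -sw exchange_big; apply: eq_bigr => j _ /=.
      by apply: eq_bigr => i _; rewrite Msym; ring.
    rewrite -mulrnAr mulr2n -{1}sw -sw' /qform.
    rewrite !(mulrDr, mulr_sumr) -!big_split /=; apply: eq_bigr => i _.
    rewrite !mulr_sumr -!big_split /=.
    by apply: eq_bigr => j _; rewrite !mxE; ring.
  have -> : sqnorm y = \sum_j (c *m M) 0 j * y 0 j - lam * \sum_i c 0 i * y 0 i.
    rewrite /sqnorm mulr_sumr -sumrB; apply: eq_bigr => i _.
    by rewrite !mxE; ring.
  by rewrite cE; ring.
set D := qform y - lam * sqnorm y in dE.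
have D0 : D <= 0 by rewrite subr_le0.
apply/eqP; rewrite eq_le sqnorm_ge0 andbT leNgt; apply/negP => y0.
have D1 : 0 < 1 - D by lra.
(* This step length [t] satisfies [t * (1 - D) = sqnorm y], so that the change becomes
   [t * (sqnorm y + t)]. *)
have := cmax (c + (sqnorm y / (1 - D)) *: y); rewrite -subr_le0 dE leNgt => /negP; apply.
set t := _ / _; have t0 : 0 < t by rewrite divr_gt0.
have tD : t * (1 - D) = sqnorm y by rewrite /t mulfVK // gt_eqF.
rewrite (_ : _ + _ = t * (sqnorm y + t)); last first.
  by rewrite -{1 2}tD; ring: tD.
by rewrite mulr_gt0 // addr_gt0.
Qed.

End SymmetricMatrix.

(** * The matrix [alpha_mx] acting on functions on the vertices *)

Section AlphaOperator.
Variables (R : realType) (alpha : R).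
Hypothesis alpha01 : 0 < alpha < 1.
Implicit Type G : sgraph.

(** The degree term of [alpha_mx] is spread over the neighbours of [v], one [alpha * x v] for
    each. *)
Definition alpha_op G (x : G -> R) (v : G) : R :=
  \sum_(w | adj v w) (alpha * x v + (1 - alpha) * x w).

Definition alpha_form G (x : G -> R) : R := \sum_v x v * alpha_op x v.

Definition row_of G (x : G -> R) : 'rV[R]_#|G| := \row_i x (enum_val i).

Lemma row_ofK G (v : 'rV[R]_#|G|) : row_of (fun a : G => v 0 (enum_rank a)) = v.
Proof. by apply/rowP => i; rewrite mxE enum_valK. Qed.

Lemma sum_enum_val G (F : G -> R) : \sum_(i < #|G|) F (enum_val i) = \sum_v F v.
Proof. by rewrite -big_enum_val. Qed.

Lemma mul_alpha_mx G (x : G -> R) i :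
  (row_of x *m alpha_mx alpha G) 0 i = alpha_op x (enum_val i).
Proof.
rewrite mxE /alpha_op big_split /= sumr_const.
under eq_bigr => j _ do rewrite !mxE mulrDr.
rewrite big_split /= (bigD1 i) //= eqxx mulr1n big1 => [|j /negPf->]; last first.
  by rewrite mulr0n !mulr0.
rewrite addr0 mulrCA mulr_natr mulrnAr -mulr_sumr; congr (_ + _).
rewrite [X in _ = _ * X]big_mkcond /=.
rewrite -(sum_enum_val (fun w => if adj (enum_val i) w then x w else 0)).
rewrite mulr_sumr; apply: eq_bigr => j _.
by rewrite adj_sym; case: ifP => _; rewrite ?mulr1 ?mulr0 // mulrC.
Qed.

Lemma sqnorm_row_of G (x : G -> R) : sqnorm (row_of x) = \sum_v x v ^+ 2.
Proof.
rewrite -(sum_enum_val (fun v => x v ^+ 2)).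
by apply: eq_bigr => i _; rewrite mxE.
Qed.

Lemma alpha_mx_sym G i j : alpha_mx alpha G i j = alpha_mx alpha G j i.
Proof.
rewrite !mxE adj_sym [in j == i]eq_sym.
by case: eqP => [->|] //; rewrite !mulr0n.
Qed.

Lemma alpha_mx_ge0 G i j : 0 <= alpha_mx alpha G i j.
Proof.
have [a0 a1] := andP alpha01.
rewrite !mxE addr_ge0 // mulr_ge0 ?mulrn_wge0 ?ler0n //; first exact: ltW.
by rewrite subr_ge0 ltW.
Qed.

Lemma qform_row_of G (x : G -> R) :
  qform (alpha_mx alpha G) (row_of x) = alpha_form x.
Proof.
rewrite /alpha_form -(sum_enum_val (fun v => x v * alpha_op x v)) /qform.
rewrite exchange_big; apply: eq_bigr => j _ /=.
rewrite -mul_alpha_mx [X in _ = _ * X]mxE mulr_sumr; apply: eq_bigr => i _.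
by rewrite !mxE; ring.
Qed.

(** The maximal Rayleigh quotient is an eigenvalue, and it bounds every other eigenvalue, since each
    is the quotient of its eigenvector. Hence it is the supremum defining [alpha_index]. *)
Lemma alpha_index_max G : (0 < #|G|)%N ->
  exists x : G -> R, [/\ forall v, 0 <= x v, \sum_v x v ^+ 2 = 1,
    forall v, alpha_op x v = alpha_index alpha G * x v &
    forall y : G -> R, alpha_form y <= alpha_index alpha G * \sum_v y v ^+ 2].
Proof.
move=> G_gt0; pose M := alpha_mx alpha G.
have [c c0 [c1 cmax]] := rayleigh_max G_gt0 (@alpha_mx_ge0 G).
have cE : c *m M = qform M c *: c.
  by apply: (rayleigh_eigen (@alpha_mx_sym G)) => //; rewrite c1 mulr1.
have idx : alpha_index alpha G = qform M c.
  have cev : [set mu | eigenvalue M mu]%classic (qform M c).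
    apply/eigenvalueP; exists c => //.
    apply: contra_eq_neq c1 => ->.
    by rewrite (eqP (_ : sqnorm 0 == 0)) ?sqnorm_eq0 // eq_sym oner_eq0.
  have cub : ubound [set mu | eigenvalue M mu]%classic (qform M c).
    move=> mu /= /eigenvalueP [v vE vn0]; have := cmax v.
    have v0 : 0 < sqnorm v by rewrite lt_def sqnorm_ge0 sqnorm_eq0 vn0.
    suff -> : qform M v = mu * sqnorm v by rewrite ler_pM2r.
    rewrite /qform exchange_big /sqnorm mulr_sumr; apply: eq_bigr => j _ /=.
    transitivity ((v *m M) 0 j * v 0 j); last by rewrite vE mxE; ring.
    by rewrite mxE mulr_suml; apply: eq_bigr => i _; ring.
  apply/eqP; rewrite eq_le; apply/andP; split.
    by apply: ge_sup => //; exists (qform M c).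
  by apply: sup_upper_bound => //; split; exists (qform M c).
exists (fun a => c 0 (enum_rank a)); split=> [v||v|y].
- exact: c0.
- by rewrite -sqnorm_row_of row_ofK.
- by rewrite -{1}[v]enum_rankK -mul_alpha_mx row_ofK cE mxE idx.
- by rewrite idx -qform_row_of -sqnorm_row_of; apply: cmax.
Qed.

(** Pairing the assumed inequality with [x] itself shows that the Rayleigh quotient of [x] is at
    least [lam]. *)
Lemma alpha_index_ge G (x : G -> R) lam : (forall v, 0 <= x v) ->
  (exists v, x v != 0) -> (forall v, lam * x v <= alpha_op x v) ->
  lam <= alpha_index alpha G.
Proof.
move=> x0 [v vn0] lamx.
have [|_ [_ _ _ /(_ x) xmax]] := @alpha_index_max G; first by apply/card_gt0P; exists v.
have s0 : 0 < \sum_v x v ^+ 2.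
  rewrite (bigD1 v) //= ltr_pwDl //; first by rewrite exprn_even_gt0.
  by apply: sumr_ge0 => w _; apply: sqr_ge0.
rewrite -(ler_pM2r s0) (le_trans _ xmax) // mulr_sumr.
by apply: ler_sum => w _; rewrite expr2 mulrCA ler_wpM2l.
Qed.

Lemma alpha_index_le_iso G H : isomorphic G H ->
  alpha_index alpha G <= alpha_index alpha H.
Proof.
move=> [f [g gf fg] fadj].
have [G0|/alpha_index_max [x [x0 x1 xE _]]] := posnP #|G|.
  have := bij_eq_card (Bijective gf fg); rewrite G0 => H0.
  (* A graph without vertices has no eigenvalue, and the supremum of the empty set is 0 by
     default. *)
  have noev (K : sgraph) : #|K| = 0%N -> alpha_index alpha K = 0.
    move=> K0; rewrite /alpha_index; apply: sup_out => -[[mu /= /eigenvalueP [v _]]].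
    by case/eqP; apply/rowP => i; have := ltn_ord i; rewrite [X in (_ < X)%N]K0.
  by rewrite !noev.
apply: (@alpha_index_ge H (x \o g)) => [v||v] /=; first exact: x0.
  have [v vn0|] := pickP (fun v => x v != 0).
    by exists (f v); rewrite /= gf.
  move=> allx0; have := oner_neq0 R; rewrite -x1 big1 ?eqxx // => v _.
  by have /negbFE/eqP -> := allx0 v; rewrite expr0n.
rewrite -xE /alpha_op (reindex g) /=; last by exists f => w _; rewrite ?gf ?fg.
by rewrite le_eqVlt; apply/orP; left; apply/eqP/eq_bigl => w; rewrite -fadj !fg.
Qed.

Lemma alpha_index_iso G H : isomorphic G H ->
  alpha_index alpha G = alpha_index alpha H.
Proof.
move=> GH; apply/eqP; rewrite eq_le !alpha_index_le_iso //.
exact: isomorphic_sym.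
Qed.

End AlphaOperator.

(** * The Perron vector of an extremal graph *)

Section Analysis.
Variables (R : realType) (alpha : R).
Local Notation beta := (1 - alpha).
Implicit Type G : sgraph.

Hypotheses (a0 : 0 < alpha) (b0 : 0 < beta).

Let alpha01 : 0 < alpha < 1. Proof. by rewrite a0 -subr_gt0. Qed.
Let an0 : alpha != 0. Proof. by rewrite gt_eqF. Qed.

Lemma alpha_opE G (x : G -> R) v : alpha_op alpha x v =
  alpha * ((degree v)%:R * x v) + beta * \sum_(w | adj v w) x w.
Proof.
rewrite /alpha_op big_split /= sumr_const mulr_sumr; congr (_ + _).
by rewrite -mulrnAr mulr_natl.
Qed.

Lemma sum_nbrs G (F : G -> R) :
  \sum_v \sum_(w | adj v w) F w = \sum_v (degree v)%:R * F v.
Proof.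
rewrite (exchange_big_dep xpredT) //=; apply: eq_bigr => w _.
rewrite sumr_const mulr_natl; congr (_ *+ _).
by apply: eq_card => v; rewrite !inE adj_sym.
Qed.

(** Each column of [alpha_mx] sums to the degree of its vertex. *)
Lemma sum_alpha_op G (x : G -> R) :
  \sum_v alpha_op alpha x v = \sum_v (degree v)%:R * x v.
Proof.
under eq_bigr do rewrite alpha_opE.
by rewrite big_split /= -!mulr_sumr sum_nbrs -mulrDl addrC subrK mul1r.
Qed.

Lemma perron_vector G : (0 < #|G|)%N -> exists (x : G -> R) (u : G),
  [/\ forall v, 0 <= x v <= 1, x u = 1 &
      forall v, alpha_op alpha x v = alpha_index alpha G * x v].
Proof.
move=> G0; have [x [x0 x1 xE _]] := alpha_index_max alpha01 G0.
have [v0 _] : exists v : G, v \in G by apply/card_gt0P.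
have [u _ umax] := @arg_maxP _ _ _ v0 xpredT x isT.
have xu : 0 < x u.
  rewrite lt_def x0 andbT; apply: contra_eq_neq x1 => xu0.
  rewrite big1 1?eq_sym ?oner_neq0 // => v _.
  have /eqP -> : x v == 0 by rewrite eq_le x0 andbT -xu0; exact: umax.
  by rewrite expr0n.
exists (fun v => x v / x u), u; split=> [v||v].
- by rewrite divr_ge0 //= ler_pdivrMr // mul1r; exact: umax.
- by rewrite divff // gt_eqF.
- rewrite mulrA -xE /alpha_op mulr_suml; apply: eq_bigr => w _; ring.
Qed.

(* The test vector is 1 on the clique and b s / (lam - a s) elsewhere, which
   makes the eigenvalue equation exact outside the clique. *)
Lemma alpha_index_split_ge n s : (0 < s)%N -> (s <= n)%N ->
  let lam := alpha * n%:R - 1 + beta * s%:R / alpha - beta / (8 * alpha) in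
  alpha * s%:R < lam ->
  8 * (beta ^+ 2 * s%:R ^+ 2 + (beta ^+ 2 * s%:R / alpha - beta / (8 * alpha)) *
    (beta * s%:R / alpha - 1 - beta / (8 * alpha) - alpha * s%:R)) / beta <= n%:R ->
  lam <= alpha_index alpha (Defs.join (complete s) (compl (complete (n - s)))).
Proof.
move=> s0 sn lam lams large.
have s0R : 0 < s%:R :> R by rewrite ltr0n.
pose y := beta * s%:R / (lam - alpha * s%:R).
have d0 : 0 < lam - alpha * s%:R by rewrite subr_gt0.
have y0 : 0 <= y by rewrite divr_ge0 ?mulr_ge0 // ltW.
pose x (v : Defs.join (complete s) (compl (complete (n - s)))) : R :=
  match v with inl _ => 1 | inr _ => y end.
apply: (alpha_index_ge alpha01 (x := x)).
- by case.
- by exists (inl (Ordinal s0)); rewrite oner_neq0.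
case=> i; rewrite /alpha_op big_sumType /=.
- rewrite !sumr_const (_ : #|_| = s.-1); last first.
    rewrite -[s in RHS]card_ord -(cardC1 i); apply: eq_card => j.
    by rewrite !inE eq_sym.
  rewrite [X in _ + _ *+ X](_ : _ = (n - s)%N); last by rewrite -[RHS]card_ord; apply: eq_card.
  rewrite -[_ *+ s.-1]mulr_natr -[_ *+ (n - s)]mulr_natr -subn1 !natrB //.
  (* The inequality at a clique vertex reduces to this one. Its right-hand side tends to
     [beta ^+ 2 * s%:R / alpha] as [n] grows, so the slack [beta / (8 * alpha)] in [lam] makes it
     true for large [n]. *)
  have : beta ^+ 2 * s%:R / alpha - beta / (8 * alpha) <= (n%:R - s%:R) * (beta * y).
    rewrite /y !mulrA ler_pdivlMr //.
    move: large; rewrite ler_pdivrMr // => large'.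
    have E : (beta ^+ 2 * s%:R / alpha - beta / (8 * alpha)) * alpha =
        beta ^+ 2 * s%:R - beta / 8 by field.
    have -> : lam - alpha * s%:R = alpha * n%:R +
      (beta * s%:R / alpha - 1 - beta / (8 * alpha) - alpha * s%:R) by rewrite /lam; ring.
    by rewrite mulrDr mulrA E; lra.
  have : beta * s%:R / alpha = beta ^+ 2 * s%:R / alpha + beta * s%:R by field.
  by rewrite /lam; lra.
- rewrite [X in _ + X]big_pred0 => [|j]; last first.
    by rewrite /= /compl_adj /= /complete_adj negbK; case: eqP.
  rewrite sumr_const (_ : #|_| = s); last by rewrite -[RHS]card_ord; apply: eq_card.
  rewrite addr0 -mulr_natr.
  have : y * (lam - alpha * s%:R) = beta * s%:R by rewrite /y divfK // gt_eqF.
  by lra.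
Qed.

(** * Perron entries on and off the hubs *)

Section Stability.
Variables (G : sgraph) (s : nat) (x : G -> R) (u : G) (r : R).
Local Notation N := (#|G|%:R : R).
(** [M] will bound the sum of [x], and [P / N] its entries outside the hubs. *)
Local Notation M := (8 * s%:R / alpha).
Local Notation P := (4 * s.+1%:R * M / alpha).
Local Notation L := (hubs G s).
Hypothesis free : ~ has_model (friendship s) G.
Hypothesis s_gt0 : (0 < s)%N.
Hypothesis x01 : forall v, 0 <= x v <= 1.
Hypothesis xu : x u = 1.
Hypothesis xE : forall v, alpha_op alpha x v = r * x v.
Hypothesis r_ge : alpha * N - 1 + beta * s%:R / alpha - beta / (8 * alpha) <= r.
Hypothesis N1 : 2 / alpha <= N.
Hypothesis N2 : 4 * s.+1%:R / alpha <= N.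
Hypothesis N3 : P < N.
Hypothesis N4 : 8 * (4 * s%:R * P + beta * s%:R / alpha + (8 * alpha)^-1) <= N.
Hypothesis N5 : (4 * s < #|G|)%N.

Let x0 v : 0 <= x v. Proof. by case/andP: (x01 v). Qed.
Let x1 v : x v <= 1. Proof. by case/andP: (x01 v). Qed.

Let N0 : 0 < N. Proof. by rewrite ltr0n; apply: leq_trans N5. Qed.

Let s1 : 1 <= s%:R :> R. Proof. by rewrite ler1n. Qed.

Let r_ge1 : alpha * N - 1 <= r.
Proof.
apply: le_trans r_ge; rewrite -addrA lerDl subr_ge0.
rewrite ler_pdivlMr // (_ : beta / (8 * alpha) * alpha = beta / 8); last by field.
by rewrite ler_pdivrMr //; have := s1; have := b0; nra.
Qed.

Let N1' : 2 <= alpha * N.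
Proof. by rewrite mulrC -ler_pdivrMr. Qed.

Let r_gt0 : 0 < r. Proof. by have := r_ge1; have := N1'; lra. Qed.

Lemma sum_degree_le : \sum_(v : G) (degree v)%:R <= 4 * s%:R * N.
Proof.
rewrite -natr_sum -card_arcs -!natrM ler_nat; exact: card_arcs_model_free.
Qed.

(** Summing the eigenvalue equation bounds [r] times the sum of [x] by the degree sum, at most
    [4 * s * N], while [r] is at least [alpha * N / 2]. *)
Lemma sum_perron_le : \sum_v x v <= M.
Proof.
rewrite -(ler_pM2l r_gt0) mulr_sumr.
under eq_bigr do rewrite -xE.
rewrite sum_alpha_op (le_trans (y := 4 * s%:R * N)) //.
  rewrite (le_trans _ sum_degree_le) //; apply: ler_sum => v _.
  by rewrite ler_piMr.
rewrite mulrA ler_pdivlMr //.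
have : alpha * N <= 2 * r by have := r_ge1; have := N1'; lra.
by have := s1; nra.
Qed.

(** The equation at [v] gives [(r - alpha * degree v) * x v <= beta * M], and the degree of a
    non-hub keeps the factor [r - alpha * degree v] of order [N]. *)
Lemma perron_nonhub_le v : v \notin L -> x v * N <= P.
Proof.
rewrite inE -ltnNge => vL.
(* For the rounded quotient [q], not being a hub means [degree v + q + 1 <= #|G|]; the extra 1 makes
   up for the rounding. *)
have dv : (degree v)%:R * (2 * s.+1%:R) <= N * (2 * s.+1%:R - 1).
  have : (degree v * (2 * s.+1) + #|G| <= #|G| * (2 * s.+1))%N.
    have := ltn_ceil #|G| (isT : 0 < 2 * s.+1)%N; set q := (_ %/ _)%N in vL *.
    move=> /ltnW Nq; apply: (@leq_trans ((degree v + q).+1 * (2 * s.+1))).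
      by rewrite -addnS mulnDl leq_add2l.
    by rewrite leq_mul2r vL orbT.
  by rewrite -(ler_nat R) natrD !natrM mulrBr mulr1; lra.
have xv : r * x v <= alpha * (degree v)%:R * x v + beta * M.
  rewrite -xE alpha_opE mulrA lerD2l ler_wpM2l ?(ltW b0) //.
  by rewrite (le_trans _ sum_perron_le) // [leRHS](bigID (adj v)) /= lerDl sumr_ge0.
have M0 : 0 <= M by rewrite divr_ge0 ?mulr_ge0 // ltW.
have S0 : 0 < s.+1%:R :> R by rewrite ltr0n.
have N2' : 4 * s.+1%:R <= alpha * N by rewrite [alpha * _]mulrC -ler_pdivrMr.
(* The degree bound leaves a gap of [alpha * N / (2 * s.+1%:R) - 1], and [N2] makes the 1 cost at
   most half of it. *)
have gap : alpha * N <= (r - alpha * (degree v)%:R) * (4 * s.+1%:R).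
  have : alpha * ((degree v)%:R * (2 * s.+1%:R)) <= alpha * (N * (2 * s.+1%:R - 1)).
    by rewrite ler_pM2l.
  by have := ler_wpM2r (ltW S0) r_ge1; lra.
have : alpha * (x v * N) <= 4 * s.+1%:R * M.
  have : (r - alpha * (degree v)%:R) * x v <= M by have := a0; nra.
  move/(ler_wpM2r (ltW S0)); have := ler_wpM2r (x0 v) gap; lra.
by rewrite ler_pdivlMr // mulrC.
Qed.

Lemma hub_perron_max : u \in L.
Proof.
by apply: contraLR N3 => /perron_nonhub_le; rewrite xu mul1r leNgt.
Qed.

Let X := \sum_(v in L) x v.
(** Extending by zero over the hubs lets sums run over all vertices and [sum_nbrs] apply. *)
Let xo v := if v \in L then 0 else x v.

Let xo0 v : 0 <= xo v. Proof. by rewrite /xo; case: ifP. Qed.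

(** The entries are at most [P / N] and the degrees sum to at most [4 * s * N]. *)
Lemma sum_degree_nonhub : \sum_v (degree v)%:R * xo v <= 4 * s%:R * P.
Proof.
rewrite -(ler_pM2r N0) mulr_suml (le_trans (y := P * (4 * s%:R * N))) //; last first.
  by rewrite [leLHS]mulrCA mulrA.
have P0 : 0 <= P by rewrite !(mulr_ge0, invr_ge0) // ltW.
apply: (@le_trans _ _ (P * \sum_(v : G) (degree v)%:R)); last by rewrite ler_wpM2l // sum_degree_le.
rewrite mulr_sumr; apply: ler_sum => v _; rewrite [leRHS]mulrC -[leLHS]mulrA ler_wpM2l //.
by rewrite /xo; case: ifPn => [_|/perron_nonhub_le //]; rewrite mul0r.
Qed.

Lemma sum_perron_split : \sum_v x v = X + \sum_v xo v.
Proof.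
rewrite (bigID (mem L)) /=; congr (_ + _).
by rewrite big_mkcond /=; apply: eq_bigr => v _; rewrite /xo if_neg.
Qed.

(** The equations at the non-hubs are summed: the hubs add at most [beta * X] to each, and the
    remaining terms add up to at most the sum in [sum_degree_nonhub]. *)
Lemma nonhub_mass_le : r * \sum_v xo v <= beta * X * N + 4 * s%:R * P.
Proof.
have X0 : 0 <= X by apply: sumr_ge0.
apply: (@le_trans _ _ (\sum_v (alpha * ((degree v)%:R * xo v) + beta * X +
    beta * \sum_(w | adj v w) xo w))).
  rewrite mulr_sumr; apply: ler_sum => v _.
  have sum0 : 0 <= \sum_(w | adj v w) xo w by apply: sumr_ge0.
  rewrite {1 2}/xo; case: ifPn => vL.
    by rewrite !mulr0 add0r addr_ge0 // mulr_ge0 // ltW.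
  rewrite -xE alpha_opE -addrA lerD2l -mulrDr ler_wpM2l ?(ltW b0) //.
  rewrite (bigID (mem L)) /= lerD //.
    rewrite /X [leRHS](bigID (adj v)) /=.
    under eq_bigl do rewrite andbC.
    by rewrite lerDl sumr_ge0.
  rewrite [leRHS](bigID (mem L)) /= ler_wpDl ?sumr_ge0 //.
  by apply: ler_sum => w /andP [_ /negPf wL]; rewrite /xo wL.
rewrite !big_split /= -!mulr_sumr sum_nbrs sumr_const.
rewrite -[X *+ _]mulr_natr mulrA (_ : #|_| = #|G|) //.
have := sum_degree_nonhub; lra.
Qed.

(* Evaluating the eigenvalue equation at u bounds r by
   alpha N - 1 + (1 - alpha) X / alpha up to O(1/N), whereas r_ge gives the same
   expression with s in place of X. *)
Lemma hub_mass_ge : s%:R - 1 / 4 <= X.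
Proof.
have X0 : 0 <= X by apply: sumr_ge0.
have XL : X <= #|L|%:R.
  by rewrite -sum1_card natr_sum; apply: ler_sum.
have Xs : X <= s%:R by rewrite (le_trans XL) // ler_nat card_hubs.
have du : (degree u)%:R <= N - 1.
  rewrite lerBrDr natr1 ler_nat; apply: proper_card.
  by apply/properP; split; [exact: subset_predT | exists u; rewrite // inE adj_irr].
(* The neighbours of [u] carry at most the total mass minus [x u = 1]. *)
have ru : r <= alpha * (N - 1) + beta * (X - 1 + \sum_v xo v).
  rewrite -[leLHS]mulr1 -xu -xE alpha_opE xu mulr1 lerD ?ler_pM2l //.
  have -> : X - 1 + \sum_v xo v = \sum_v x v - 1 by rewrite sum_perron_split addrAC.
  rewrite [\sum_v x v](bigD1 u) //= xu [1 + _ - 1]addrAC subrr add0r.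
  rewrite [leRHS](bigID (adj u)) /= ler_wpDr ?sumr_ge0 //.
  rewrite le_eqVlt; apply/orP; left; apply/eqP/eq_bigl => w.
  by apply/idP/andP => [uw|[]//]; split; rewrite // eq_sym adj_neq.
(* Multiplying by [alpha * N - 1 <= r] turns the extra [(8 * alpha)^-1] into [N / 8], which by [N4]
   absorbs all bounded terms. *)
have So : \sum_v xo v <= beta * X / alpha + (8 * alpha)^-1.
  rewrite -(ler_pM2l r_gt0) (le_trans nonhub_mass_le) //.
  apply: (@le_trans _ _ ((alpha * N - 1) * (beta * X / alpha + (8 * alpha)^-1))); last first.
    by rewrite ler_wpM2r // addr_ge0 ?invr_ge0 ?divr_ge0 ?mulr_ge0 // ltW.
  have -> : (alpha * N - 1) * (beta * X / alpha + (8 * alpha)^-1) =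
      beta * X * N + N / 8 - (beta * X / alpha + (8 * alpha)^-1) by field.
  have : beta * X / alpha <= beta * s%:R / alpha by rewrite ler_pM2r ?invr_gt0 // ler_pM2l.
  by have := N4; lra.
(* The right-hand side is twice [beta / (8 * alpha)]: once from the slack in [r_ge], once from
   [So]. *)
have : beta * s%:R / alpha - beta * X / alpha <= beta / (4 * alpha).
  have e1 : beta * X / alpha = beta * X + beta * (beta * X / alpha) by field.
  have e2 : beta / (4 * alpha) = 2 * (beta / (8 * alpha)) by field.
  have e3 : beta * (8 * alpha)^-1 = beta / (8 * alpha) by [].
  have : beta * \sum_v xo v <= beta * (beta * X / alpha + (8 * alpha)^-1) by rewrite ler_pM2l.
  by move: ru r_ge; rewrite !(mulrDr beta); lra.
have -> : beta * s%:R / alpha - beta * X / alpha = (beta / alpha) * (s%:R - X) by field.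
have -> : beta / (4 * alpha) = (beta / alpha) * (1 / 4) by field.
by rewrite ler_pM2l ?divr_gt0 //; lra.
Qed.

(** As the entries are at most 1, fewer than [s] hubs would have mass at most [s - 1], below
    [hub_mass_ge]. *)
Lemma card_hubs_eq : #|L| = s.
Proof.
apply/eqP; rewrite eqn_leq card_hubs //= leqNgt; apply/negP => Ls.
have : X <= s%:R - 1.
  rewrite (le_trans (y := #|L|%:R)) //.
    by rewrite -sum1_card natr_sum; apply: ler_sum.
  by rewrite lerBrDr natr1 ler_nat.
have := hub_mass_ge; lra.
Qed.

(** The other [s - 1] hubs carry at most [s - 1] of the mass, which leaves at least 3/4 for [v]. *)
Lemma hub_perron_ge v : v \in L -> 1 / 2 <= x v.
Proof.
move=> vL; have : X <= x v + (s%:R - 1).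
  rewrite /X (bigD1 v) //= lerD2l.
  apply: (@le_trans _ _ (\sum_(i in L | i != v) 1)); first exact: ler_sum.
  have -> : s%:R = 1 + \sum_(i in L | i != v) 1 :> R.
    by rewrite -[in LHS]card_hubs_eq -sum1_card natr_sum (bigD1 v).
  by rewrite addrAC subrr add0r.
have := hub_mass_ge; lra.
Qed.

End Stability.
End Analysis.

(** Summing over ordered pairs lets the forms of two graphs on the same vertices be compared pair by
    pair. *)
Lemma alpha_formE (R : realType) (alpha : R) (G : sgraph) (x : G -> R) :
  alpha_form alpha x =
  \sum_(p : G * G) (adj p.1 p.2)%:R * (x p.1 * (alpha * x p.1 + (1 - alpha) * x p.2)).
Proof.
rewrite -(pair_bigA _ (fun v w => (adj v w)%:R * (x v * (alpha * x v + (1 - alpha) * x w)))) /=.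
apply: eq_bigr => v _; rewrite /alpha_op mulr_sumr big_mkcond /=.
by apply: eq_bigr => w _; case: adj; rewrite ?mul1r ?mul0r.
Qed.

Lemma eventually_ge (R : realType) (cs : seq R) :
  exists n0 : nat, forall n, (n0 <= n)%N -> all (fun c => c <= n%:R) cs.
Proof.
elim: cs => [|c cs [n0 IH]]; first by exists 0%N.
exists (maxn (Num.bound `|c|) n0) => n; rewrite geq_max => /andP [cn /IH] /= ->.
rewrite andbT (le_trans (ler_norm c)) //.
by rewrite (le_trans (ltW (archi_boundP (normr_ge0 c)))) // ler_nat.
Qed.

(** * Comparison with the extremal graph *)

Section Extremal.
Variables (R : realType) (alpha : R) (G : sgraph) (s : nat).
Hypotheses (a0 : 0 < alpha) (b0 : 0 < 1 - alpha).
Local Notation beta := (1 - alpha).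
Local Notation N := (#|G|%:R : R).
Local Notation P := (4 * s.+1%:R * (8 * s%:R / alpha) / alpha).
Local Notation K := (Defs.join (complete s) (compl (complete (#|G| - s)))).

Lemma extremal_iso : ~ has_model (friendship s) G -> (0 < s)%N ->
  alpha * N - 1 + beta * s%:R / alpha - beta / (8 * alpha) <= alpha_index alpha K ->
  alpha_index alpha K <= alpha_index alpha G ->
  2 / alpha <= N -> 4 * s.+1%:R / alpha <= N -> P < N ->
  8 * (4 * s%:R * P + beta * s%:R / alpha + (8 * alpha)^-1) <= N ->
  (4 * s < #|G|)%N -> 16 * s%:R * P ^+ 2 / alpha < N ->
  isomorphic G K.
Proof.
move=> free s0 rK KG N1 N2 N3 N4 N5 N6.
have alpha01 : 0 < alpha < 1 by rewrite a0 -subr_gt0.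
have G0 : (0 < #|G|)%N by apply: leq_trans N5.
have N0 : 0 < N by rewrite ltr0n.
have [x [u [x01 xu xE]]] := perron_vector a0 b0 G0.
have rG := le_trans rK KG.
have x0 v : 0 <= x v by case/andP: (x01 v).
pose L := hubs G s.
have cL : #|L| = s by apply: (card_hubs_eq a0 b0 free s0 x01 xu xE rG).
have uL : u \in L by apply: (hub_perron_max a0 b0 free s0 x01 xu xE rG).
have xL v : v \in L -> 1 / 2 <= x v.
  by apply: (hub_perron_ge a0 b0 free s0 x01 xu xE rG).
have xnL v : v \notin L -> x v <= P / N.
  move=> vL; rewrite ler_pdivlMr //.
  by apply: (perron_nonhub_le a0 b0 free s0 x01 xE rG).
have GK := split_graph_iso cL erefl.
pose H := split_graph L.
(* On [G] the eigenvector [x] attains the index of [G]; on [H] it is only a test vector, and the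
   index of [H] is that of [K], which is no larger. *)
have formH : alpha_form alpha (x : H -> R) <= alpha_form alpha x.
  have [_ [_ _ _ /(_ x) le1]] := @alpha_index_max _ _ alpha01 H G0.
  apply: le_trans le1 _.
  have -> : alpha_form alpha x = alpha_index alpha G * \sum_v x v ^+ 2.
    by rewrite /alpha_form mulr_sumr; apply: eq_bigr => v _; rewrite xE; ring.
  apply: ler_wpM2r; first by apply: sumr_ge0 => v _; exact: sqr_ge0.
  by rewrite (alpha_index_iso alpha01 GK).
(* The entries of x outside L are O(1/N) and G has O(N) edges, so the edges of G
   missing in H contribute O(1/N) to the quadratic form, less than the
   contribution of a single edge of H missing in G. *)
have full a b : a \in L -> a != b -> adj a b.
  move=> aL ab; apply/negPn/negP => nab; move: formH; apply/negP; rewrite -ltNge.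
  rewrite -subr_gt0 !alpha_formE -sumrB.
  pose c := (P / N) ^+ 2.
  have c0 : 0 <= c by exact: sqr_ge0.
  (* The absent pair [(a, b)] gains at least [alpha / 4], since [x a] is at least 1/2; each arc of
     [G] loses at most [c]. The total loss [4 * s * N * c] is below [alpha / 4] by [N6]. *)
  apply: (@lt_le_trans _ _ (\sum_(p : G * G)
      ((p == (a, b))%:R * (alpha / 4) - (adj p.1 p.2)%:R * c))).
    rewrite sumrB (bigD1 (a, b)) //= eqxx mul1r big1 => [|p /negPf->]; last by rewrite mul0r.
    rewrite addr0 -mulr_suml subr_gt0.
    have -> : \sum_(p : G * G) (adj p.1 p.2)%:R = \sum_(v : G) (degree v)%:R :> R.
      rewrite -[RHS]natr_sum -card_arcs -sum1_card natr_sum [RHS]big_mkcond /=.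
      by apply: eq_bigr => p _; rewrite inE; case: adj.
    apply: (@le_lt_trans _ _ (4 * s%:R * N * c)).
      by rewrite ler_wpM2r // (sum_degree_le _ free).
    have -> : 4 * s%:R * N * c = 4 * s%:R * P ^+ 2 / N by rewrite /c; field; rewrite !gt_eqF.
    rewrite ltr_pdivrMr //; move: N6; rewrite ltr_pdivrMr //; lra.
  apply: ler_sum => -[v w] _ /=; rewrite -mulrBl /split_adj.
  have q0 : 0 <= x v * (alpha * x v + beta * x w).
    by rewrite mulr_ge0 // addr_ge0 // mulr_ge0 // ltW.
  case: eqP => [[-> ->]|_].
    rewrite (negPf nab) ab aL /= subr0 !mul1r mul0r subr0.
    rewrite (_ : alpha / 4 = 1 / 2 * (alpha * (1 / 2))); last by field.
    have xb : 0 <= beta * x b by rewrite mulr_ge0 // ltW.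
    rewrite ler_pM ?xL // ?mulr_ge0 ?divr_ge0 ?ler01 ?ler0n ?(ltW a0) //.
    by rewrite -[leLHS]addr0 lerD // ler_pM2l ?xL.
  rewrite mul0r sub0r; have [k|nk] := boolP ((v != w) && _).
    apply: (@le_trans _ _ 0); first by rewrite oppr_le0 mulr_ge0.
    by rewrite mulr_ge0 //; case: adj; rewrite /= ?subrr ?subr0.
  rewrite sub0r mulNr lerN2; have [vw|] := boolP (adj v w); last by rewrite !mul0r.
  move: nk; rewrite (adj_neq vw) /= negb_or => /andP [vL wL].
  rewrite !mul1r /c expr2 ler_pM //; last first.
    move: (xnL v vL) (xnL w wL); set p := P / N => xv xw.
    have : alpha * x v <= alpha * p by rewrite ler_pM2l.
    have : beta * x w <= beta * p by rewrite ler_pM2l.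
    by lra.
  - exact: xnL.
  - by rewrite addr_ge0 // mulr_ge0 // ltW.
have [f fbij fadj] := GK; exists f => // v w; rewrite fadj /= /split_adj.
apply/idP/idP => [/andP [vw /orP [vL|wL]]|vw].
- exact: full.
- by rewrite adj_sym full // eq_sym.
rewrite (adj_neq vw) /=; apply/norP => -[vL wL].
have nu z : z \notin L -> u != z by apply: contraNneq => <-.
(* As all edges at hubs are present, [v] and [w] form a triangle with the hub [u]. *)
apply: (hubs_no_triangle free N5 cL uL vL wL vw); apply: full => //; exact: nu.
Qed.

End Extremal.

Theorem theorem1p1 (R : realType) (alpha : R) (s : nat) :
  0 < alpha < 1 -> (1 <= s)%N ->
  exists n0 : nat, forall n : nat, (n0 <= n)%N ->
    forall G : sgraph, #|G| = n -> minor_free (friendship s) G ->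
      let K := join (complete s) (compl (complete (n - s))) in
      alpha_index alpha G <= alpha_index alpha K
      /\ (alpha_index alpha G = alpha_index alpha K <-> isomorphic G K).
Proof.
move=> alpha01 s0; have [a0 a1] := andP alpha01.
have b0 : 0 < 1 - alpha by rewrite subr_gt0.
pose P := 4 * s.+1%:R * (8 * s%:R / alpha) / alpha.
(* The added 1 turns a bound into a strict one. The last two entries serve the lower bound on the
   index of [K], the first of them ensuring [alpha * s < lam] there. *)
have [n0 large] := eventually_ge [::
  2 / alpha; 4 * s.+1%:R / alpha; P + 1;
  8 * (4 * s%:R * P + (1 - alpha) * s%:R / alpha + (8 * alpha)^-1);
  16 * s%:R * P ^+ 2 / alpha + 1;
  (alpha * s%:R + 1 + (1 - alpha) / (8 * alpha)) / alpha;
  8 * ((1 - alpha) ^+ 2 * s%:R ^+ 2 +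
    ((1 - alpha) ^+ 2 * s%:R / alpha - (1 - alpha) / (8 * alpha)) *
    ((1 - alpha) * s%:R / alpha - 1 - (1 - alpha) / (8 * alpha) - alpha * s%:R)) /
    (1 - alpha)].
exists (maxn n0 (4 * s).+1) => n; rewrite geq_max => /andP [/large].
case/and5P=> N1 N2 N3 N4 /and4P [N6 N7 N8 _] N5 G cG free K.
(* This implication also yields the inequality: a strictly larger index of [G] would make [G]
   isomorphic to [K], hence the two indices equal. *)
suff KG : alpha_index alpha K <= alpha_index alpha G -> isomorphic G K.
  split; last split=> [GK|]; last exact: alpha_index_iso.
    rewrite leNgt; apply/negP => GK.
    by move: (GK); rewrite (alpha_index_iso alpha01 (KG (ltW GK))) ltxx.
  by apply: KG; rewrite GK.
rewrite /K -cG in N1 N2 N3 N4 N5 N6 N7 N8 * => KG.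
apply: (extremal_iso a0 b0) => //.
- by move=> /minor_of_has_model.
- have sn : (s <= #|G|)%N by apply: leq_trans (ltnW N5); rewrite leq_pmull.
  apply: (alpha_index_split_ge a0 b0 s0 sn _ N8).
  move: N7; rewrite ler_pdivrMr //.
  have : 0 < (1 - alpha) * s%:R / alpha by rewrite divr_gt0 ?mulr_gt0 // ltr0n.
  lra.
- by rewrite (lt_le_trans _ N3) // ltrDl.
- by rewrite (lt_le_trans _ N6) // ltrDl.
Qed.
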